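(* Let $u\in W$ be the unique weak solution of the radiative transfer problem, i.e. $t(u,v)=s(u,v)+\ell(v)$ for all $v\in W$. For any initial guess $u_0\in L^2(D)$, let the sequence $\{u_k\}$ be defined for $k\ge 0$ by the following two steps: $u_{k+1/2}\in W$ solves $$t(u_{k+1/2},v)=s(u_k,v)+\ell(v)\qquad\text{for all } v\in W,$$ and $$u_{k+1}:=u_{k+1/2}+u^c_{k+1/2},\qquad u^c_{k+1/2}:=\operatorname*{argmin}_{w\in W_N}\|\mathcal R(u_{k+1/2}+w)\|_{\sigma_t},$$ where $W_N\subset W$ is a linear subspace of finite dimension $N$ (which may be chosen differently in each step $k$). Then, with $r_0:=\mathcal R(u_0)$, the sequence $\{u_k\}$ converges linearly to $u$ with rate $\rho$, i.e. $$\|u-u_k\|_{\sigma_t}\le\frac{\rho^k}{1-\rho}\,\|r_0\|_{\sigma_t}\qquad\text{for all } k\ge 0.$$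
   Context: Setting. Let $R\subset\mathbb R^d$ be a domain with Lipschitz boundary and outward unit normal $\mathbf n(\mathbf r)$, $S^{d-1}$ the unit sphere, $D:=R\times S^{d-1}$, $\partial D:=\partial R\times S^{d-1}$ and $\partial D_-:=\{(\mathbf r,\mathbf s)\in\partial R\times S^{d-1}:\mathbf n(\mathbf r)\cdot\mathbf s<0\}$. The gradient $\nabla$ acts in $\mathbf r$ only. The problem is the weak form of $\mathbf s\cdot\nabla u+\sigma_t u=\mathcal S u+q$ in $D$, $u=q_\partial$ on $\partial D_-$. Data. $\sigma_s,\sigma_t:R\to\mathbb R$ are positive and essentially bounded, $\sigma_t=\sigma_a+\sigma_s$, and there is $c_0>0$ with $\sigma_a\ge c_0$ a.e. in $R$; $\rho:=\|\sigma_s/\sigma_t\|_\infty<1$. The phase function $\theta:[-1,1]\to\mathbb R$ is non-negative with $\int_{S^{d-1}}\theta(\mathbf s\cdot\mathbf s')\,d\mathbf s'=1$ for a.e. $\mathbf s$. Sources: $q\in L^2(D)$ and $q_\partial\in L^2(\partial D_-;|\mathbf s\cdot\mathbf n|)$. Put $(\mathcal S v)(\mathbf r,\mathbf s):=\sigma_s(\mathbf r)\int_{S^{d-1}}\theta(\mathbf s\cdot\mathbf s')v(\mathbf r,\mathbf s')\,d\mathbf s'$ for $v\in L^2(D)$. Spaces. $V_0:=L^2(D)$ with inner product $(\cdot,\cdot)$; $V_1:=\{v\in V_0:\mathbf s\cdot\nabla v\in V_0,\ v|_{\partial D_-}\in L^2(\partial D_-;|\mathbf s\cdot\mathbf n|)\}$,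 the completion of $C^\infty(\overline D)$ under the norm induced by $(v,w)+(\mathbf s\cdot\nabla v,\mathbf s\cdot\nabla w)+\int_{\partial D_-}|\mathbf s\cdot\mathbf n|\,v\,w$. Even/odd parts: $v^\pm(\mathbf r,\mathbf s):=\tfrac12(v(\mathbf r,\mathbf s)\pm v(\mathbf r,-\mathbf s))$; $V^\pm:=\{v^\pm:v\in V\}$. $W:=V_1^+\oplus V_0^-$. Weighted norm: $\|v\|_{\sigma_t}:=\|\sqrt{\sigma_t}\,v\|_{L^2(D)}$. Forms: $t(u,v):=(\mathbf s\cdot\nabla u^+,v^-)-(u^-,\mathbf s\cdot\nabla v^+)+(\sigma_t u,v)+\int_{\partial D}|\mathbf s\cdot\mathbf n|\,u^+v^+$ for $u,v\in W$, $\ s(u,v):=(\mathcal S u,v)$ (which makes sense for $u,v\in L^2(D)$), $\ \ell(v):=(q,v)-2\int_{\partial D_-}\mathbf s\cdot\mathbf n\,q_\partial\,v^+$ for $v\in W$. It is known that the weak problem $t(u,v)=s(u,v)+\ell(v)$ for all $v\in W$, and, for given $w\in L^2(D)$, the problem of finding $z\in W$ with $t(z,v)=s(w,v)+\ell(v)$ for all $v\in W$, are uniquely solvable in $W$. Preconditioned residual: for $w\in L^2(D)$, $\mathcal R(w):=z-w$, where $z\in W$ solves $t(z,v)=s(w,v)+\ell(v)$ for all $v\in W$. For $w\in W$ this is equivalent to: $\mathcal R(w)\in W$ and $t(\mathcal R(w),v)=\ell(v)-t(w,v)+s(w,v)$ for all $v\in W$. The minimizer defining $u^c_{k+1/2}$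 exists and is unique. *)

(* Defs.v *)
From HB Require Import structures.
From mathcomp Require Import all_boot all_order all_algebra.
From mathcomp Require Import all_classical all_reals all_analysis.
From mathcomp Require Import measurable_realfun ess_sup_inf.

Set Implicit Arguments.
Unset Strict Implicit.
Unset Printing Implicit Defensive.

Import Order.TTheory GRing.Theory Num.Theory.
Import numFieldNormedType.Exports.

Local Open Scope classical_set_scope.
Local Open Scope ring_scope.

Definition row_display : measure_display. Proof. exact: default_measure_display. Qed.

Section measurable_matrix.
Context (R : realType) (m n : nat).

(* The sigma-algebra generated by the coordinates, i.e. the Borel one. *)
Definition coords_system : set (set 'M[R]_(m, n)) :=
  \bigcup_(ij in [set: 'I_m * 'I_n])
    preimage_set_system setT (fun A : 'M[R]_(m, n) => A ij.1 ij.2) measurable.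

Let mx0 : <<s coords_system >> set0.
Proof. exact: sigma_algebra0. Qed.

Let mxC A : <<s coords_system >> A -> <<s coords_system >> (~` A).
Proof. exact: sigma_algebraC. Qed.

Let mxU (F : (set _)^nat) : (forall i, <<s coords_system >> (F i)) ->
  <<s coords_system >> (\bigcup_i (F i)).
Proof. exact: sigma_algebra_bigcup. Qed.

HB.instance Definition _ := @isMeasurable.Build row_display
  'M[R]_(m, n) <<s coords_system >> mx0 mxC mxU.

Lemma measurable_entry i j :
  measurable_fun setT (fun A : 'M[R]_(m, n) => A i j).
Proof.
move=> _ B mB; apply: sub_sigma_algebra.
by exists (i, j) => //; exists B.
Qed.

Lemma measurable_fun_mx d (T : measurableType d) (f : T -> 'M[R]_(m, n)) :
  (forall i j, measurable_fun setT (fun x => f x i j)) -> measurable_fun setT f.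
Proof.
move=> mf; apply: (@measurability _ _ _ _ _ f coords_system) => //.
move=> _ [_ [[i j] _ [B mB <-]] <-].
rewrite !setTI; have := mf i j measurableT B mB.
by rewrite setTI.
Qed.

End measurable_matrix.

Section euclidean.
Context (R : realType) (n : nat).
Implicit Types x y : 'rV[R]_n.

Definition dotv x y : R := \sum_(i < n) x 0 i * y 0 i.
Definition enorm x : R := Num.sqrt (dotv x x).
Definition uball : set 'rV[R]_n := [set x | enorm x <= 1].
Definition usphere : set 'rV[R]_n := [set x | enorm x = 1].
Definition unitv x : 'rV[R]_n := (enorm x)^-1 *: x.

End euclidean.

Section lebesgue_step.
Context (R : realType) (n : nat).

Definition consrow (p : measurableTypeR R * 'rV[R]_n) : 'rV[R]_n.+1 :=
  \row_(i < n.+1) oapp (p.2 0) p.1 (unlift 0 i).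

Definition unconsrow (v : 'rV[R]_n.+1) : measurableTypeR R * 'rV[R]_n :=
  (v 0 0, \row_(i < n) v 0 (lift 0 i)).

Lemma consrowK : cancel consrow unconsrow.
Proof.
move=> [x v]; rewrite /unconsrow /consrow mxE unlift_none /=; congr pair.
by apply/rowP => i; rewrite !mxE liftK.
Qed.

Lemma measurable_consrow : measurable_fun setT consrow.
Proof.
apply: measurable_fun_mx => i j; rewrite ord1 {i}.
have [k ->|->] := unliftP 0 j.
- under eq_fun do rewrite mxE liftK /=.
  exact: (measurableT_comp (@measurable_entry R 1 n 0 k) measurable_snd).
- under eq_fun do rewrite mxE unlift_none /=.
  exact: measurable_fst.
Qed.

Lemma measurable_unconsrow : measurable_fun setT unconsrow.
Proof.
apply/measurable_fun_pairP; split; first exact: measurable_entry.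
apply: measurable_fun_mx => i j /=.
rewrite [X in measurable_fun _ X](_ : _ = fun v : 'rV[R]_n.+1 => v 0 (lift 0 j)).
  exact: measurable_entry.
by apply/funext => v /=; rewrite mxE.
Qed.

Variable mu : {sigma_finite_measure set 'rV[R]_n -> \bar R}.

Definition leb_cons : set 'rV[R]_n.+1 -> \bar R :=
  pushforward (@lebesgue_measure R \x mu)%E consrow.

Let leb_cons0 : leb_cons set0 = 0%E.
Proof. by rewrite /leb_cons /pushforward preimage_set0 measure0. Qed.

Let leb_cons_ge0 A : (0 <= leb_cons A)%E.
Proof. by rewrite /leb_cons /pushforward; exact: measure_ge0. Qed.

Let leb_cons_additive : semi_sigma_additive leb_cons.
Proof.
move=> F mF tF mUF; rewrite /leb_cons /pushforward preimage_bigcup.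
apply: measure_semi_sigma_additive.
- by move=> k; rewrite -[X in measurable X]setTI; exact: measurable_consrow.
- apply/trivIsetP => /= i j _ _ ij; rewrite -preimage_setI.
  by move/trivIsetP : tF => /(_ _ _ _ _ ij) ->//; rewrite preimage_set0.
- by rewrite -preimage_bigcup -[X in measurable X]setTI; exact: measurable_consrow.
Qed.

HB.instance Definition _ := isMeasure.Build _ _ _ leb_cons
  leb_cons0 leb_cons_ge0 leb_cons_additive.

Let leb_cons_sigma_finite : sigma_finite setT leb_cons.
Proof.
have /sigma_finiteP[F [FT ndF Ffin]] := sigma_finiteT (@lebesgue_measure R).
have /sigma_finiteP[G [GT ndG Gfin]] := sigma_finiteT mu.
exists (fun k => unconsrow @^-1` (F k `*` G k)).
  rewrite -preimage_bigcup (_ : \bigcup_k _ = setT) ?preimage_setT//.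
  apply/seteqP; split => // -[x y] _.
  have [i _ Fx] : (\bigcup_i F i) x by rewrite -FT.
  have [j _ Gy] : (\bigcup_i G i) y by rewrite -GT.
  exists (maxn i j) => //; split => /=.
  - by move: x Fx; exact/subsetPset/ndF/leq_maxl.
  - by move: y Gy; exact/subsetPset/ndG/leq_maxr.
move=> k; have [mF Fk] := Ffin k; have [mG Gk] := Gfin k.
have mFG : measurable (F k `*` G k) by exact: measurableX.
split; first by rewrite -[X in measurable X]setTI; exact: measurable_unconsrow.
rewrite /leb_cons /pushforward -comp_preimage.
rewrite (_ : unconsrow \o consrow = id); last first.
  by apply/funext => p /=; rewrite consrowK.
by rewrite product_measure1E// lte_mul_pinfty// ge0_fin_numE.
Qed.

HB.instance Definition _ := @Measure_isSigmaFinite.Build _ _ _ leb_cons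
  leb_cons_sigma_finite.

End lebesgue_step.

(* Lebesgue measure on R^n, as an iterated product of the one-dimensional one. *)
Fixpoint leb (R : realType) (n : nat) :
    {sigma_finite_measure set 'rV[R]_n -> \bar R} :=
  if n is k.+1 then @leb_cons R k (leb R k) else dirac (0 : 'rV[R]_0).

Lemma measurable_cube (R : realType) (n : nat) (M : R) :
  measurable [set v : 'rV[R]_n | forall i, `|v 0 i| <= M].
Proof.
rewrite (_ : [set _ | _] = \bigcap_(i in [set: 'I_n])
    ((fun v : 'rV[R]_n => v 0 i) @^-1` `[- M, M]%classic)).
  apply: fin_bigcap_measurable => // i _.
  by rewrite -[X in measurable X]setTI; exact: measurable_entry.
apply/seteqP; split => v /= H i; last first.
  by have := H i Logic.I; rewrite /= in_itv/= ler_norml.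
by move=> _ /=; rewrite in_itv/= -ler_norml.
Qed.

Lemma leb_cube_lty (R : realType) (n : nat) (M : R) :
  (leb R n [set v : 'rV[R]_n | forall i, (`|v 0 i| <= M)%R] < +oo)%E.
Proof.
elim: n => [|n ih] /=.
  by rewrite diracE; case: (_ \in _); rewrite ltry.
rewrite /leb_cons /pushforward.
rewrite (_ : _ @^-1` _ = `[- M, M]%classic `*`
    [set v : 'rV[R]_n | forall i, `|v 0 i| <= M]); last first.
  apply/seteqP; split => [[x v]/= H|[x v]/= [xM vM] i].
    split.
      by have := H 0; rewrite mxE unlift_none/= in_itv/= ler_norml.
    by move=> i; have := H (lift 0 i); rewrite mxE liftK.
  rewrite mxE; case: unliftP => [j _|_] //=.
  by rewrite ler_norml; move: xM; rewrite in_itv.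
have mcube := @measurable_cube R n M.
rewrite product_measure1E// lte_mul_pinfty//.
rewrite ge0_fin_numE//= lebesgue_measure_itv/=.
by case: ifP => _; rewrite ?ltry// -EFinD ltry.
Qed.

Section sphere.
Context (R : realType) (n : nat).

Lemma measurable_enorm : measurable_fun setT (@enorm R n).
Proof.
apply: (@measurableT_comp _ _ _ _ _ _ (@Num.sqrt R)).
  by apply: continuous_measurable_fun; exact: sqrt_continuous.
apply: measurable_sum => i.
by apply: measurable_funM; exact: measurable_entry.
Qed.

Lemma measurable_unitv : measurable_fun setT (@unitv R n).
Proof.
apply: measurable_fun_mx => i j; rewrite ord1.
rewrite (_ : (fun _ => _) =
    (fun x : 'rV[R]_n => enorm x `^ (-1) * x 0 j)); last first.
  by apply/funext => x; rewrite mxE powR_inv1// sqrtr_ge0.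
apply: measurable_funM; last exact: measurable_entry.
apply: (@measurableT_comp _ _ _ _ _ _ (@powR R ^~ (-1))) => //.
exact: measurable_enorm.
Qed.

Definition punctured_ball : set 'rV[R]_n := [set x | 0 < enorm x <= 1].

Let mpb : measurable punctured_ball.
Proof.
rewrite (_ : punctured_ball = @enorm R n @^-1` `]0, 1]%classic); last first.
  by apply/seteqP; split => x /=; rewrite in_itv.
by rewrite -[X in measurable X]setTI; exact: measurable_enorm.
Qed.

(* Surface measure on the unit sphere, in polar coordinates: n times the volume
   of the cone over A. *)
Definition sphere_measure (A : set 'rV[R]_n) : \bar R :=
  (n%:R%:E * leb R n (@unitv R n @^-1` A `&` punctured_ball))%E.

Let mpre A : measurable A -> measurable (@unitv R n @^-1` A).
Proof.
by move=> mA; rewrite -[X in measurable X]setTI; exact: measurable_unitv.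
Qed.

Let sphere0 : sphere_measure set0 = 0%E.
Proof.
rewrite /sphere_measure preimage_set0 set0I measure0; exact: mule0.
Qed.

Let sphere_ge0 A : (0 <= sphere_measure A)%E.
Proof. by apply: mule_ge0 => //; rewrite lee_fin. Qed.

Let sphere_additive : semi_sigma_additive sphere_measure.
Proof.
move=> F mF tF mU; rewrite /sphere_measure.
rewrite preimage_bigcup.
pose mu := mscale (NngNum (ler0n R n)) (mrestr (leb R n) mpb).
have tG : trivIset setT (fun k => @unitv R n @^-1` F k).
  apply/trivIsetP => /= i j _ _ ij; rewrite -preimage_setI.
  by move/trivIsetP : tF => /(_ _ _ _ _ ij) ->//; rewrite preimage_set0.
have mUG : measurable (\bigcup_k @unitv R n @^-1` F k).
  by rewrite -preimage_bigcup; exact: mpre.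
exact: (@measure_semi_sigma_additive _ _ _ mu _
  (fun k => mpre (mF k)) tG mUG).
Qed.

HB.instance Definition _ := isMeasure.Build _ _ _ sphere_measure
  sphere0 sphere_ge0 sphere_additive.

Let sphere_fin : fin_num_fun sphere_measure.
Proof.
move=> A mA; rewrite ge0_fin_numE ?measure_ge0//.
rewrite /sphere_measure lte_mul_pinfty// ?lee_fin//.
apply: (le_lt_trans _ (leb_cube_lty n 1)).
apply: le_measure; rewrite ?inE.
- by apply: measurableI => //; exact: mpre.
- exact: measurable_cube.
move=> x [_ /andP[_ x1]] i; apply: le_trans x1.
rewrite /enorm -sqrtr_sqr ler_wsqrtr// /dotv (bigD1 i)//= -expr2 lerDl.
by apply: sumr_ge0 => j _; rewrite -expr2 sqr_ge0.
Qed.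

HB.instance Definition _ := Measure_isFinite.Build _ _ _ sphere_measure
  sphere_fin.

End sphere.

Section hausdorff.
Context (R : realType) (n : nat).

(* -oo for the empty set, which [ball_weight] therefore treats apart. *)
Definition ediam (A : set 'rV[R]_n) : \bar R :=
  ereal_sup [set (enorm (x - y))%:E | x in A & y in A].

(* Volume of the m-dimensional ball of diameter diam A. *)
Definition ball_weight (m : nat) (A : set 'rV[R]_n) : \bar R :=
  if `[< A = set0 >] then 0%E
  else (leb R m (@uball R m) * (((2^-1 ^+ m)%R)%:E * ediam A ^+ m))%E.

Definition hausdorff_delta (m : nat) (delta : R) (A : set 'rV[R]_n) : \bar R :=
  ereal_inf [set (\sum_(0 <= k <oo) ball_weight m (F k))%E | F in
    [set F : nat -> set 'rV[R]_n |
      A `<=` \bigcup_k F k /\ forall k, (ediam (F k) <= delta%:E)%E]].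

(* Hausdorff (outer) measure, normalised so as to be the surface area on smooth
   m-dimensional surfaces. *)
Definition hausdorff (m : nat) (A : set 'rV[R]_n) : \bar R :=
  ereal_sup [set hausdorff_delta m delta A | delta in [set delta | 0 < delta]].

End hausdorff.

Section domains.
Context (R : realType) (d : nat).
Implicit Types (O : set 'rV[R]_d) (r e : 'rV[R]_d).

Definition bdry O : set 'rV[R]_d := closure O `\` interior O.

(* Near each boundary point O is the part of space above the graph, in the
   direction e, of a Lipschitz function g of the component orthogonal to e. *)
Definition lipschitz_boundary O := forall r0, bdry O r0 ->
  exists e (g : 'rV[R]_d -> R) (L rad : R),
    [/\ enorm e = 1, 0 < rad,
        forall x y, `|g x - g y| <= L * enorm (x - y) &
        forall r, enorm (r - r0) < rad ->
          (O r <-> g (r - dotv r e *: e) < dotv r e)].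

Definition lipschitz_domain O :=
  [/\ open O, connected O, O !=set0 & lipschitz_boundary O].

(* nu is the outward unit normal of O at r if, at r, the boundary is tangent to
   the hyperplane orthogonal to nu and nu points out of O; for a Lipschitz graph
   this holds exactly where the graph is differentiable. *)
Definition is_outward_normal O r (nu : 'rV[R]_d) :=
  enorm nu = 1 /\
  forall eps : R, 0 < eps -> exists2 delta : R, 0 < delta &
    forall x, 0 < enorm (x - r) < delta ->
      (dotv (x - r) nu <= - eps * enorm (x - r) -> O x) /\
      (eps * enorm (x - r) <= dotv (x - r) nu -> ~ O x).

(* This determines S: it is the Borel measure H^(d-1) restricted to the boundary. *)
Definition is_surface_measure O (S : {measure set 'rV[R]_d -> \bar R}) :=
  forall A, measurable A -> S A = hausdorff d.-1 (A `&` bdry O).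

Definition is_normal_field O (S : {measure set 'rV[R]_d -> \bar R})
    (nu : 'rV[R]_d -> 'rV[R]_d) :=
  measurable_fun setT nu /\
  {ae S, forall r, bdry O r -> is_outward_normal O r (nu r)}.

End domains.

Section lebesgue_spaces.
Context dd (T : measurableType dd) (R : realType).
Variables (mu : {measure set T -> \bar R}) (D : set T).

Definition L2norm (f : T -> R) : \bar R := ('N[mu]_2%:E[EFin \o (f \_ D)])%E.
Definition L2 (f : T -> R) : Prop := (f \_ D) \in Lfun mu 2%:E.
Definition Linftynorm (f : T -> R) : \bar R := ('N[mu]_+oo[EFin \o (f \_ D)])%E.
Definition Linfty (f : T -> R) : Prop := (f \_ D) \in Lfun mu +oo%E.
Definition L2inner (f g : T -> R) : R := \int[mu]_(x in D) (f x * g x).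

End lebesgue_spaces.

Fixpoint Ck (R : realType) (V : normedModType R) (k : nat) (f : V -> R) : Prop :=
  if k is k'.+1
  then (forall x, differentiable f x) /\ forall v, Ck k' (fun x => 'D_v f x)
  else continuous f.

Definition smooth (R : realType) (V : normedModType R) (f : V -> R) : Prop :=
  forall k, Ck k f.

Notation phase R d := ('rV[R]_d * 'rV[R]_d)%type.

(* An element of W, together with the data of its even part needed by the bilinear
   form: (values of w, directional derivative s.grad w^+, boundary values of w^+). *)
Notation rte_fun R d :=
  ((phase R d -> R) * (phase R d -> R) * (phase R d -> R))%type.

Section parts.
Context (R : realType) (d : nat).
Implicit Types (f : phase R d -> R) (w : rte_fun R d).

Definition even_part f : phase R d -> R :=
  fun x => (f x + f (x.1, - x.2)) / 2.
Definition odd_part f : phase R d -> R :=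
  fun x => (f x - f (x.1, - x.2)) / 2.

Definition value w : phase R d -> R := w.1.1.
Definition sgrad w : phase R d -> R := w.1.2.
Definition bval w : phase R d -> R := w.2.

End parts.

Record rte (R : realType) (d : nat) := Rte {
  dom : set 'rV[R]_d;
  surf : {measure set 'rV[R]_d -> \bar R};
  normal : 'rV[R]_d -> 'rV[R]_d;
  sigma_a : 'rV[R]_d -> R;
  sigma_s : 'rV[R]_d -> R;
  theta : R -> R;
  source : phase R d -> R;
  inflow_source : phase R d -> R }.

Section transfer.
Context (R : realType) (d : nat) (P : rte R d).
Local Notation X := (phase R d).
Implicit Types (f g b : X -> R) (u v w z : rte_fun R d).

Definition sigma_t (r : 'rV[R]_d) : R := sigma_a P r + sigma_s P r.

Definition phase_dom : set X := dom P `*` @usphere R d.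
Definition muD : {measure set X -> \bar R} := (leb R d \x @sphere_measure R d)%E.

Definition sn (x : X) : R := dotv x.2 (normal P x.1).
Definition phase_bdry : set X := bdry (dom P) `*` @usphere R d.
Definition inflow_bdry : set X := phase_bdry `&` [set x | sn x < 0].
Definition mubD : {measure set X -> \bar R} :=
  (surf P \x @sphere_measure R d)%E.
(* b is in L^2(inflow_bdry; |s.n|) iff [bweight b] is in L^2(inflow_bdry),
   with the same norm. *)
Definition bweight b : X -> R := fun x => Num.sqrt `|sn x| * b x.

Definition rho : R :=
  fine (Linftynorm (leb R d) (dom P) (fun r => sigma_s P r / sigma_t r)).

Definition admissible (c0 : R) : Prop :=
  [/\ lipschitz_domain (dom P),
      is_surface_measure (dom P) (surf P) &
      is_normal_field (dom P) (surf P) (normal P)] /\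
  [/\ Linfty (leb R d) (dom P) (sigma_s P),
      Linfty (leb R d) (dom P) sigma_t,
      {ae leb R d, forall r, dom P r -> 0 < sigma_s P r /\ 0 < sigma_t r},
      0 < c0 &
      {ae leb R d, forall r, dom P r -> c0 <= sigma_a P r}] /\
  [/\ measurable_fun [set t : R | -1 <= t <= 1] (theta P),
      forall t, -1 <= t <= 1 -> 0 <= theta P t &
      {ae @sphere_measure R d, forall s, usphere s ->
        (\int[@sphere_measure R d]_(s' in @usphere R d)
          (theta P (dotv s s'))%:E = 1)%E}] /\
  [/\ L2 muD phase_dom (source P) & L2 mubD inflow_bdry (bweight (inflow_source P))].

Definition scattering f : X -> R := fun x =>
  sigma_s P x.1 * \int[@sphere_measure R d]_(s' in @usphere R d)
    (theta P (dotv x.2 s') * f (x.1, s')).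

(* V_1 as the completion of the smooth functions: (f, g, b) is the limit of
   (phi, s.grad phi, phi on the inflow boundary) in
   L^2(D) x L^2(D) x L^2(inflow_bdry; |s.n|).  Smooth functions on the closure of D are
   restrictions of smooth functions on the ambient space, and s.grad phi is the
   derivative in the direction (s, 0). *)
Definition V1 f g b : Prop :=
  [/\ L2 muD phase_dom f, L2 muD phase_dom g, L2 mubD inflow_bdry (bweight b) &
      exists phi : nat -> X -> R, (forall k, smooth (phi k)) /\
      [/\ (fun k => L2norm muD phase_dom (fun x => phi k x - f x)) @ \oo --> 0%E,
          (fun k => L2norm muD phase_dom
             (fun x => 'D_((x.2, 0) : X) (phi k) x - g x)) @ \oo --> 0%E &
          (fun k => L2norm mubD inflow_bdry
             (bweight (fun x => phi k x - b x))) @ \oo --> 0%E]].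

(* W = V_1^+ (+) V_0^-.  V_1 is invariant under s -> -s, so that V_1^+ consists of
   its even elements.  V_1 controls boundary values on the inflow part only; those
   of an even function are even in s, which determines them on the outflow part. *)
Definition W : set (rte_fun R d) := [set w |
  [/\ V1 (even_part (value w)) (sgrad w) (bval w),
      L2 muD phase_dom (odd_part (value w)) &
      forall x, phase_bdry x -> bval w (x.1, - x.2) = bval w x]].

Definition tform u v : R :=
  L2inner muD phase_dom (sgrad u) (odd_part (value v))
  - L2inner muD phase_dom (odd_part (value u)) (sgrad v)
  + L2inner muD phase_dom (fun x => sigma_t x.1 * value u x) (value v)
  + \int[mubD]_(x in phase_bdry) (`|sn x| * bval u x * bval v x).

Definition sform f g : R := L2inner muD phase_dom (scattering f) g.

Definition ell v : R :=
  L2inner muD phase_dom (source P) (value v)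
  - 2 * \int[mubD]_(x in inflow_bdry) (sn x * inflow_source P x * bval v x).

Definition weak_solution u : Prop :=
  W u /\ forall v, W v -> tform u v = sform (value u) (value v) + ell v.

Definition transport_solution f z : Prop :=
  W z /\ forall v, W v -> tform z v = sform f (value v) + ell v.

Definition transport_solvable : Prop :=
  forall f, L2 muD phase_dom f -> exists z, transport_solution f z.

(* [xget] picks the solution, which is unique up to a null set. *)
Definition residual f : X -> R :=
  fun x => value (xget 0 (transport_solution f)) x - f x.

Definition sigma_norm f : \bar R :=
  L2norm muD phase_dom (fun x => Num.sqrt (sigma_t x.1) * f x).

Definition subspace_of_dim (N : nat) (WN : set (rte_fun R d)) : Prop :=
  exists e : 'I_N -> rte_fun R d,
    [/\ forall i, W (e i),
        forall a : 'I_N -> R,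
          {ae muD, forall x, phase_dom x -> value (\sum_(i < N) a i *: e i) x = 0} ->
          forall i, a i = 0 &
        WN = range (fun a : 'I_N -> R => \sum_(i < N) a i *: e i)].

Definition is_argmin (WN : set (rte_fun R d)) (F : rte_fun R d -> \bar R) w :=
  WN w /\ forall w', WN w' -> (F w <= F w')%E.

End transfer.

(* Main.v *)
Require Import Defs.
From mathcomp Require Import all_boot all_order all_algebra.
From mathcomp Require Import all_classical all_reals all_analysis.
From mathcomp Require Import measurable_realfun ess_sup_inf ring lra.

(**
  Let [u] and [z] solve the transport problem with scattering data [f] and [g].
  Testing both with [u] and [z] and combining the four equations, the gradient
  terms of [t] cancel by antisymmetry and the boundary term is nonnegative, so
  that [|u - z|^2 <= s (f - g, u - z)] in the weighted norm.  Since
  [sigma_s <= rho sigma_t] and [h v rho <= (rho^2 h^2 + v^2) / 2], while the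
  phase function has unit mass in each of its two directions, Tonelli bounds the
  right-hand side by [(rho^2 |f - g|^2 + |u - z|^2) / 2]: the solution map is a
  [rho]-contraction.  Hence half a step multiplies the residual by at most
  [rho], and the correction cannot increase it because [0] is a competitor;
  finally [|u - u_k| <= rho |u - u_k| + |r_k|].
*)

Set Implicit Arguments.
Unset Strict Implicit.
Unset Printing Implicit Defensive.

Import Order.TTheory GRing.Theory Num.Theory.
Import numFieldNormedType.Exports.

Local Open Scope classical_set_scope.
Local Open Scope ring_scope.

(** * Null sets of product measures *)

Section ae_product.
Local Open Scope ereal_scope.
Context d1 d2 (T1 : measurableType d1) (T2 : measurableType d2) (R : realType).
Variables (m1 : {measure set T1 -> \bar R}).
Variables (m2 : {sigma_finite_measure set T2 -> \bar R}).

Lemma ae_product1 (Q : T1 -> Prop) :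
  {ae m1, forall x, Q x} -> {ae m1 \x m2, forall x, Q x.1}.
Proof.
move=> [N [mN N0 QN]]; exists (N `*` setT); split.
- exact: measurableX.
- by rewrite /= product_measure1E// N0 mul0e.
- by move=> x /= nQ; split => //; exact: QN.
Qed.

Lemma ae_product2 (Q : T2 -> Prop) :
  {ae m2, forall x, Q x} -> {ae m1 \x m2, forall x, Q x.2}.
Proof.
move=> [N [mN N0 QN]]; exists (setT `*` N); split.
- exact: measurableX.
- by rewrite /= product_measure1E// N0 mule0.
- by move=> x /= nQ; split => //; exact: QN.
Qed.

End ae_product.

(** * Square-integrable functions and their products *)

Section square_integrable.
Local Open Scope ereal_scope.
Context d (T : measurableType d) (R : realType).
Variable mu : {measure set T -> \bar R}.
Implicit Types f g : T -> R.

Lemma Lfun2P f : f \in Lfun mu 2%:E <->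
  measurable_fun setT f /\ \int[mu]_x ((f x ^+ 2)%R)%:E < +oo.
Proof.
have E : \int[mu]_x (`|(f x)%:E| `^ 2) = \int[mu]_x ((f x ^+ 2)%R)%:E.
  by apply: eq_integral => x _ /=; rewrite powR_mulrn// real_normK// num_real.
have ge0 : 0 <= \int[mu]_x ((f x ^+ 2)%R)%:E.
  by apply: integral_ge0 => x _; rewrite lee_fin sqr_ge0.
have NE : 'N[mu]_2%:E[EFin \o f] = (\int[mu]_x ((f x ^+ 2)%R)%:E) `^ 2^-1.
  by rewrite unlock E.
split.
- rewrite inE => /andP[]; rewrite !inE /= => mf; rewrite /finite_norm NE.
  by move/lty_poweRy => ->//; rewrite invr_eq0 pnatr_eq0.
- move=> [mf ltf]; rewrite inE; apply/andP; split; rewrite inE//=.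
  by rewrite /finite_norm NE; apply: poweR_lty.
Qed.

Lemma Lfun2_integrable_sqr f : f \in Lfun mu 2%:E ->
  mu.-integrable setT (fun x => ((f x ^+ 2)%R)%:E).
Proof.
move=> /Lfun2P[mf f2]; apply/integrableP; split.
  by apply/measurable_EFinP; exact: measurable_funX.
rewrite (eq_integral (fun x => ((f x ^+ 2)%R)%:E))// => x _.
by rewrite gee0_abs// lee_fin sqr_ge0.
Qed.

(** The product is dominated by [f ^+ 2 + g ^+ 2]; the crude constant is enough, as only
    integrability is at stake. *)
Lemma Lfun2_integrableM f g : f \in Lfun mu 2%:E -> g \in Lfun mu 2%:E ->
  mu.-integrable setT (fun x => (f x * g x)%:E).
Proof.
move=> /Lfun2P[mf f2] /Lfun2P[mg g2].
apply: (@le_integrable _ _ _ _ _ measurableT _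
   (fun x => ((f x ^+ 2)%R)%:E + ((g x ^+ 2)%R)%:E)).
- by apply/measurable_EFinP; exact: measurable_funM.
- move=> x _; rewrite -EFinD !abse_EFin lee_fin.
  rewrite [leRHS]ger0_norm ?addr_ge0 ?sqr_ge0// normrM.
  rewrite -[X in (_ <= X + _)%R]real_normK ?num_real//.
  rewrite -[X in (_ <= _ + X)%R]real_normK ?num_real//.
  nra.
- by apply: integrableD => //; apply: Lfun2_integrable_sqr; apply/Lfun2P.
Qed.

End square_integrable.

(** * Essential bounds and real-valued integrals *)

Section integration.
Context d (T : measurableType d) (R : realType).
Variable mu : {measure set T -> \bar R}.
Implicit Types f g h : T -> R.

(** The norm of exponent [+oo] is an essential supremum only if the whole space has positive
    measure; otherwise every property holds almost everywhere. *)
Lemma Lnormy_ae h :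
  ({ae mu, forall x, `|h x|%:E <= 'N[mu]_+oo[EFin \o h]})%E.
Proof.
rewrite unlock; case: ifPn => [_|]; first exact: ess_sup_ge.
rewrite lt_neqAle measure_ge0 andbT negbK eq_sym => /eqP mu0.
by exists setT; split.
Qed.

(** The signs are those of a bilinear form expanded at [(u - z, u - z)]; the boundary, absorption
    and scattering terms are all merged in this way. *)
Lemma RintegralBBD (a b c e : T -> R) :
  mu.-integrable setT (EFin \o a) -> mu.-integrable setT (EFin \o b) ->
  mu.-integrable setT (EFin \o c) -> mu.-integrable setT (EFin \o e) ->
  \int[mu]_x (a x - b x - c x + e x) =
  \int[mu]_x a x - \int[mu]_x b x - \int[mu]_x c x + \int[mu]_x e x.
Proof.
move=> ia ib ic ie.
have iab : mu.-integrable setT (EFin \o (fun x => a x - b x)).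
  by apply: eq_integrable (integrableB measurableT ia ib).
have iabc : mu.-integrable setT (EFin \o (fun x => a x - b x - c x)).
  by apply: eq_integrable (integrableB measurableT iab ic).
by rewrite RintegralD// RintegralB// RintegralB.
Qed.

Lemma Rintegral_ae_eq f g :
  mu.-integrable setT (EFin \o f) -> measurable_fun setT g ->
  {ae mu, forall x, f x = g x} -> \int[mu]_x f x = \int[mu]_x g x.
Proof.
move=> /integrableP[mf _] mg fg; rewrite /Rintegral; congr fine.
apply: ae_eq_integral => //; first exact/measurable_EFinP.
by apply: filterS fg => x /= -> _.
Qed.

Lemma Lfun2B f g : f \in Lfun mu 2%:E -> g \in Lfun mu 2%:E ->
  (f \- g) \in Lfun mu 2%:E.
Proof. by move=> f2 g2; apply: rpredB => //; exact: lee1n. Qed.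

End integration.

(** * Averaging against a symmetric kernel *)

Section scattering_kernel.
Local Open Scope ereal_scope.
Context d1 d2 (T1 : measurableType d1) (T2 : measurableType d2) (R : realType).
Variables (m1 : {sigma_finite_measure set T1 -> \bar R}).
Variables (m2 : {sigma_finite_measure set T2 -> \bar R}).
Variable k : T2 * T2 -> R.
Hypothesis mk : measurable_fun setT k.
Hypothesis k0 : forall p, (0 <= k p)%R.
Hypothesis k_sym : forall s s', k (s, s') = k (s', s).
Hypothesis k_le1 : {ae m2, forall s, \int[m2]_s' (k (s, s'))%:E <= 1}.
Local Notation mu := (m1 \x m2).
Implicit Types (g : T1 * T2 -> \bar R) (f h v : T1 * T2 -> R).

(** The average with values in the extended reals, to which Tonelli applies for nonnegative [g]. The
    real-valued [kernel_opr] is the one that occurs in the scattering term. *)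
Definition kernel_op g (x : T1 * T2) : \bar R :=
  \int[m2]_s' ((k (x.2, s'))%:E * g (x.1, s')).

Definition kernel_opr f (x : T1 * T2) : R :=
  (\int[m2]_s' (k (x.2, s') * f (x.1, s')))%R.

Lemma measurable_kernel1 s : measurable_fun setT (fun s' => k (s, s')).
Proof. exact: (measurableT_comp mk (measurable_pair1 s)). Qed.

(** With the integrand seen as a function of [((r, s), s')], the average is a partial integral,
    whose measurability is part of Tonelli's theorem. *)
Let mKg (g : T1 * T2 -> \bar R) : measurable_fun setT g ->
  measurable_fun setT (fun p : (T1 * T2) * T2 =>
    (k (p.1.2, p.2))%:E * g (p.1.1, p.2)).
Proof.
move=> mg; apply: emeasurable_funM.
  apply/measurable_EFinP; apply: (measurableT_comp mk).
  exact: (measurable_fun_pair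
    (measurableT_comp measurable_snd measurable_fst) measurable_snd).
apply: (measurableT_comp mg).
exact: (measurable_fun_pair
  (measurableT_comp measurable_fst measurable_fst) measurable_snd).
Qed.

Lemma measurable_kernel_op g : measurable_fun setT g -> (forall x, 0 <= g x) ->
  measurable_fun setT (kernel_op g).
Proof.
move=> mg g0; apply: (measurable_fun_fubini_tonelli_F (m2 := m2)
  (fun p : (T1 * T2) * T2 => (k (p.1.2, p.2))%:E * g (p.1.1, p.2))).
  exact: mKg.
by move=> p; rewrite mule_ge0// lee_fin.
Qed.

Lemma kernel_op_ge0 g : (forall x, 0 <= g x) -> forall x, 0 <= kernel_op g x.
Proof.
by move=> g0 x; apply: integral_ge0 => s _; rewrite mule_ge0// lee_fin.
Qed.

(** Exchanging [s] and [s'] leaves the integral of [k] over its first argument; by symmetry this is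
    the mass [kap], which is at most [1] almost everywhere. *)
Lemma integral_kernel_op g : measurable_fun setT g -> (forall x, 0 <= g x) ->
  \int[mu]_x kernel_op g x <= \int[mu]_x g x.
Proof.
move=> mg g0.
pose kap (s : T2) := \int[m2]_s' (k (s, s'))%:E.
have kap0 s : 0 <= kap s by apply: integral_ge0 => s' _; rewrite lee_fin.
have mkap : measurable_fun setT kap.
  apply: (measurable_fun_fubini_tonelli_F (m2 := m2) (EFin \o k)) => //.
    exact/measurable_EFinP.
have mgk : measurable_fun setT (fun x : T1 * T2 => kap x.2 * g x).
  by apply: emeasurable_funM => //; exact: (measurableT_comp mkap measurable_snd).
have -> : \int[mu]_x kernel_op g x = \int[mu]_x (kap x.2 * g x).
  rewrite (fubini_tonelli1 _ (measurable_kernel_op mg g0) (kernel_op_ge0 g0)).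
  rewrite (fubini_tonelli1 _ mgk); last by move=> x; rewrite mule_ge0.
  apply: eq_integral => r _; rewrite /fubini_F /kernel_op /=.
  rewrite (fubini_tonelli (m1 := m2) (m2 := m2)
    (fun p : T2 * T2 => (k (p.1, p.2))%:E * g (r, p.2)))//=; last 2 first.
  - apply: emeasurable_funM.
      apply/measurable_EFinP; rewrite (_ : (fun _ => _) = k)//.
      by apply/funext => -[].
    apply: (measurableT_comp mg).
    exact: (measurable_fun_pair (measurable_cst r) measurable_snd).
  - by move=> p; rewrite mule_ge0// lee_fin.
  apply: eq_integral => s' _.
  rewrite ge0_integralZr//.
  - by congr (_ * _); apply: eq_integral => s _; rewrite k_sym.
  - apply/measurable_EFinP.
    exact: (measurableT_comp mk (measurable_pair2 s')).
  - by move=> s _; rewrite lee_fin.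
apply: ae_ge0_le_integral => //.
- by move=> x _; rewrite mule_ge0.
- apply: filterS (ae_product2 m1 k_le1) => x /= kx _.
  by rewrite -[leRHS]mul1e; apply: lee_pmul.
Qed.

Lemma measurable_kernel_opr f :
  measurable_fun setT f -> measurable_fun setT (kernel_opr f).
Proof.
move=> mf; rewrite /kernel_opr /Rintegral.
apply: measurableT_comp; first exact: fine_measurable.
have mF : measurable_fun setT (fun p : (T1 * T2) * T2 =>
    (k (p.1.2, p.2) * f (p.1.1, p.2))%:E).
  by apply: (mKg (g := EFin \o f)); exact/measurable_EFinP.
(* [f] has no sign, so Tonelli is applied to the positive and the negative part. *)
under eq_fun do rewrite integralE.
apply: emeasurable_funB.
- have := measurable_fun_fubini_tonelli_F (m2 := m2) _
    (measurable_funepos mF) (funepos_ge0 _).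
  congr (measurable_fun _ _); apply/funext => x.
  by apply: eq_integral => s' _; rewrite !funeposE.
- have := measurable_fun_fubini_tonelli_F (m2 := m2) _
    (measurable_funeneg mF) (funeneg_ge0 _).
  congr (measurable_fun _ _); apply/funext => x.
  by apply: eq_integral => s' _; rewrite !funenegE.
Qed.

(** Valid at every [x]: where the inner integral is infinite, [fine] turns it into [0]. *)
Lemma le_norm_kernel_opr f x : measurable_fun setT f ->
  `|kernel_opr f x|%:E <= kernel_op (fun y => `|f y|%:E) x.
Proof.
move=> mf; rewrite /kernel_opr /Rintegral /kernel_op.
have mkf : measurable_fun setT (fun s' => (k (x.2, s') * f (x.1, s'))%:E).
  apply/measurable_EFinP; apply: measurable_funM.
    exact: measurable_kernel1.
  exact: (measurableT_comp mf (measurable_pair1 _)).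
apply: (@le_trans _ _ `|\int[m2]_s' (k (x.2, s') * f (x.1, s'))%:E|).
  by case: (\int[m2]_s' _) => [r||] //=; rewrite leey.
apply: le_trans (le_abse_integral _ _ _) _ => //.
rewrite le_eqVlt; apply/orP; left; apply/eqP; apply: eq_integral => s' _.
by rewrite abse_EFin normrM ger0_norm// EFinM.
Qed.

(** From [|f| <= 1 + f ^+ 2]: the average of [1] is at most [1], and the average of [f ^+ 2] is
    integrable, hence finite almost everywhere. *)
Lemma kernel_op_lty_ae f : f \in Lfun mu 2%:E ->
  {ae mu, forall x, kernel_op (fun y => `|f y|%:E) x < +oo}.
Proof.
move=> /Lfun2P[mf f2].
have mf2 : measurable_fun setT (fun x => ((f x ^+ 2)%R)%:E).
  by apply/measurable_EFinP; exact: measurable_funX.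
have f20 x : 0 <= ((f x ^+ 2)%R)%:E by rewrite lee_fin sqr_ge0.
have /integrable_ae : mu.-integrable setT (kernel_op (fun x => ((f x ^+ 2)%R)%:E)).
  apply/integrableP; split; first exact: measurable_kernel_op.
  under eq_integral do rewrite gee0_abs ?kernel_op_ge0//.
  exact: le_lt_trans (integral_kernel_op mf2 f20) f2.
move=> /(_ measurableT); apply: filterS2 (ae_product2 m1 k_le1) => x kx kf2.
have mks : measurable_fun setT (fun s' => (k (x.2, s'))%:E).
  by apply/measurable_EFinP; exact: measurable_kernel1.
have mfx (g : T1 * T2 -> \bar R) : measurable_fun setT g ->
    measurable_fun setT (fun s' => g (x.1, s')).
  by move=> mg; exact: (measurableT_comp mg (measurable_pair1 _)).
apply: (@le_lt_trans _ _ (\int[m2]_s' (k (x.2, s'))%:E +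
    kernel_op (fun x => ((f x ^+ 2)%R)%:E) x)); last first.
  rewrite lte_add_pinfty//; first exact: le_lt_trans kx (ltry _).
  by have := kf2 Logic.I; rewrite fin_numE ltey => /andP[_].
rewrite -ge0_integralD//.
- apply: ge0_le_integral => //.
  + by move=> s _; rewrite mule_ge0// lee_fin.
  + apply: emeasurable_funM => //; apply: (mfx (fun x => `|f x|%:E)).
    by apply/measurable_EFinP; exact: measurableT_comp.
  + apply: emeasurable_funD => //; apply: emeasurable_funM => //.
    exact: (mfx (fun x => ((f x ^+ 2)%R)%:E)).
  + move=> s _; rewrite -!EFinM -EFinD lee_fin.
    rewrite -[X in (_ <= X + _)%R]mulr1 -mulrDr ler_wpM2l//.
    rewrite -[X in (_ <= _ + X)%R]real_normK ?num_real//; nra.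
- by move=> s _; rewrite lee_fin.
- by move=> s _; rewrite mule_ge0// lee_fin.
- by apply: emeasurable_funM => //; exact: (mfx (fun x => ((f x ^+ 2)%R)%:E)).
Qed.

Lemma integrable_kernel f x : measurable_fun setT f ->
  kernel_op (fun y => `|f y|%:E) x < +oo ->
  m2.-integrable setT (fun s' => (k (x.2, s') * f (x.1, s'))%:E).
Proof.
move=> mf kf; apply/integrableP; split.
  apply/measurable_EFinP; apply: measurable_funM.
    exact: measurable_kernel1.
  exact: (measurableT_comp mf (measurable_pair1 _)).
rewrite (eq_integral (fun s' => (k (x.2, s'))%:E * `|f (x.1, s')|%:E))// => s _.
by rewrite abse_EFin normrM ger0_norm// EFinM.
Qed.

(** Linearity holds where both averages converge absolutely, hence only almost everywhere. *)
Lemma kernel_oprB f h : f \in Lfun mu 2%:E -> h \in Lfun mu 2%:E ->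
  {ae mu, forall x, kernel_opr (f \- h)%R x = (kernel_opr f x - kernel_opr h x)%R}.
Proof.
move=> f2 h2; have [mf _] := (Lfun2P mu f).1 f2; have [mh _] := (Lfun2P mu h).1 h2.
apply: filterS2 (kernel_op_lty_ae f2) (kernel_op_lty_ae h2) => x kf kh.
rewrite -RintegralB//; [|exact: integrable_kernel..].
by apply: eq_Rintegral => s _ /=; rewrite mulrBr.
Qed.

Variables (sig tau : T1 -> R) (rho : R).
Hypotheses (msig : measurable_fun setT sig) (mtau : measurable_fun setT tau).
Hypotheses (tau0 : {ae m1, forall r, 0 <= tau r <= rho * sig r}%R).
Hypotheses (sig0 : forall r, (0 <= sig r)%R).

(** Here [tau] is the scattering and [sig] the total coefficient. Both depend on the position only,
    so they can be moved inside the average over directions. AM-GM under that average leaves [H] at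
    [s'] plus [V] at [s]: the mass of the kernel in one argument disposes of [V], that in the other
    of [H]. *)
Lemma integral_scattering_le h v : h \in Lfun mu 2%:E -> v \in Lfun mu 2%:E ->
  \int[mu]_x `|tau x.1 * kernel_opr h x * v x|%:E <=
  (2^-1)%:E * (\int[mu]_x (rho ^+ 2 * sig x.1 * h x ^+ 2)%:E +
           \int[mu]_x (sig x.1 * v x ^+ 2)%:E).
Proof.
move=> /Lfun2P[mh _] /Lfun2P[mv _].
have msigx : measurable_fun setT (fun x : T1 * T2 => sig x.1).
  exact: (measurableT_comp msig measurable_fst).
have V20 x : (0 <= sig x.1 * v x ^+ 2)%R.
  by apply: mulr_ge0 => //; exact: sqr_ge0.
have H20 x : (0 <= rho ^+ 2 * sig x.1 * h x ^+ 2)%R.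
  by rewrite -mulrA; apply: mulr_ge0; [exact: sqr_ge0|apply: mulr_ge0 => //;
    exact: sqr_ge0].
have half0 : (0 <= 2^-1 :> R)%R by rewrite invr_ge0.
pose H (x : T1 * T2) := ((2^-1 * (rho ^+ 2 * sig x.1 * h x ^+ 2))%R)%:E.
pose V (x : T1 * T2) := ((2^-1 * (sig x.1 * v x ^+ 2))%R)%:E.
have mH : measurable_fun setT H.
  apply/measurable_EFinP; do 2 apply: measurable_funM => //.
    exact: measurable_funM.
  exact: measurable_funX.
have mV : measurable_fun setT V.
  apply/measurable_EFinP; do 2 apply: measurable_funM => //.
  exact: measurable_funX.
have H0 x : 0 <= H x by rewrite lee_fin; exact: mulr_ge0.
have V0 x : 0 <= V x by rewrite lee_fin; exact: mulr_ge0.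
have kH0 := kernel_op_ge0 H0; have mkH := measurable_kernel_op mH H0.
apply: (@le_trans _ _ (\int[mu]_x (kernel_op H x + V x))); last first.
  rewrite ge0_integralD// ge0_muleDr ?integral_ge0//; last 2 first.
  - by move=> x _; rewrite lee_fin.
  - by move=> x _; rewrite lee_fin.
  rewrite -!ge0_integralZl_EFin//.
  - by apply: leeD => //; exact: integral_kernel_op.
  - by move=> x _; rewrite lee_fin.
  - apply/measurable_EFinP; apply: measurable_funM => //.
    exact: measurable_funX.
  - by move=> x _; rewrite lee_fin.
  - apply/measurable_EFinP; apply: measurable_funM => //.
      exact: measurable_funM.
    exact: measurable_funX.
apply: ae_ge0_le_integral => //.
- apply/measurable_EFinP; apply: measurableT_comp => //.
  apply: measurable_funM => //; apply: measurable_funM; last exact: measurable_kernel_opr.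
  exact: (measurableT_comp mtau measurable_fst).
- by move=> x _; rewrite adde_ge0.
- exact: emeasurable_funD.
apply: filterS2 (ae_product1 m2 tau0) (ae_product2 m1 k_le1) => x /andP[t0 ts] kx _.
have mks : measurable_fun setT (fun s' => (k (x.2, s'))%:E).
  by apply/measurable_EFinP; exact: measurable_kernel1.
have mhx : measurable_fun setT (fun s' => h (x.1, s')).
  exact: (measurableT_comp mh (measurable_pair1 _)).
have mHx : measurable_fun setT (fun s' => H (x.1, s')).
  exact: (measurableT_comp mH (measurable_pair1 _)).
(* [V x] is constant in [s'], so its average is at most [V x]. *)
apply: (@le_trans _ _ (kernel_op H x + \int[m2]_s' ((k (x.2, s'))%:E * V x)));
    last first.
  apply: leeD2l; rewrite ge0_integralZr//; last by move=> s _; rewrite lee_fin.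
  by rewrite -[leRHS]mul1e; apply: lee_wpmul2r.
rewrite -ge0_integralD//; last 4 first.
- by move=> s _; rewrite mule_ge0// lee_fin.
- exact: emeasurable_funM.
- by move=> s _; rewrite mule_ge0// lee_fin.
- exact: emeasurable_funM.
apply: (@le_trans _ _ ((tau x.1 * `|v x|)%:E * kernel_op (fun y => `|h y|%:E) x)).
  rewrite -mulrA (mulrC (kernel_opr h x)) mulrA normrM EFinM normrM (ger0_norm t0).
  by rewrite lee_wpmul2l ?le_norm_kernel_opr// lee_fin mulr_ge0.
rewrite -ge0_integralZl_EFin ?mulr_ge0//; last 2 first.
- by move=> s _; rewrite mule_ge0// lee_fin.
- apply: emeasurable_funM => //; apply/measurable_EFinP.
  exact: measurableT_comp.
apply: ge0_le_integral => //.
- by move=> s _; rewrite !mule_ge0// lee_fin// mulr_ge0.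
- apply: emeasurable_funM => //; apply: emeasurable_funM => //.
  by apply/measurable_EFinP; exact: measurableT_comp.
- by apply: emeasurable_funD => //; exact: emeasurable_funM.
move=> s _; rewrite -!EFinM -EFinD lee_fin /=.
rewrite mulrCA -mulrDr ler_wpM2l//.
(* AM-GM, after bounding [tau] by [rho * sig] *)
apply: (@le_trans _ _ (rho * sig x.1 * `|v x| * `|h (x.1, s)|)%R).
  by do 2 rewrite ler_wpM2r//.
rewrite -[X in (_ <= _ * (_ * X) + _)%R]real_normK ?num_real//.
rewrite -[X in (_ <= _ + _ * (_ * X))%R]real_normK ?num_real//.
have := sqr_ge0 (rho * `|h (x.1, s)| - `|v x|)%R.
by have := sig0 x.1; nra.
Qed.

End scattering_kernel.
(** * Reversal of the direction *)

Section reflection.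
Context (R : realType).

Lemma measurable_oppmx n : measurable_fun setT (-%R : 'rV[R]_n -> 'rV[R]_n).
Proof.
apply: measurable_fun_mx => i j; under eq_fun do rewrite mxE.
by apply: measurable_funN; exact: measurable_entry.
Qed.

(** Induction on the dimension: the induction hypothesis reflects the sections at a fixed first
    coordinate, and the invariance of the one-dimensional measure reflects that coordinate. *)
Lemma lebN n (A : set 'rV[R]_n) : measurable A ->
  leb R n (-%R @^-1` A) = leb R n A.
Proof.
elim: n A => [A _|n ih A mA] /=.
  rewrite !diracE; congr (_%:R%:E); congr (nat_of_bool _).
  by apply/idP/idP; rewrite !inE /= oppr0.
rewrite /leb_cons /pushforward.
have mB : measurable (consrow (n := n) @^-1` A : set (measurableTypeR R * 'rV[R]_n)).
  by rewrite -[X in measurable X]setTI; exact: measurable_consrow.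
set B := consrow (n := n) @^-1` A in mB *.
have consrowN x v : consrow (- x, - v) = - consrow (x, v) :> 'rV[R]_n.+1.
  apply/rowP => i; rewrite !mxE.
  by case: unliftP => [j _|_] //=; rewrite mxE.
pose phi (x : measurableTypeR R) := leb R n (xsection B x).
have mphi : measurable_fun setT phi by exact: measurable_fun_xsection.
transitivity (\int[@lebesgue_measure R]_x phi (- x)%R)%E.
  rewrite /product_measure1; apply: eq_integral => x _ /=.
  rewrite /phi -[RHS]ih; last exact: measurable_xsection.
  congr (leb R n _); apply/seteqP; split => v; rewrite /xsection /= !inE /B /=.
    by rewrite consrowN.
  by rewrite consrowN.
(* The change of variable [x -> - x] is written as a pushforward, and the pushed measure is again
   Lebesgue measure. *)
pose opp : measurableTypeR R -> measurableTypeR R := (-%R : R -> R).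
have mopp : measurable_fun setT opp by exact: oppr_measurable.
have phi0 : {in setT, forall x, (0 <= phi x)%E} by move=> x _; exact: measure_ge0.
have /= <- := ge0_integral_pushforward mopp lebesgue_measure measurableT mphi phi0.
by apply: eq_measure_integral => /= C mC _; exact: lebesgue_measureN.
Qed.

Lemma dotvN n (x : 'rV[R]_n) : dotv (- x) (- x) = dotv x x.
Proof. by apply: eq_bigr => i _; rewrite mxE mulrNN. Qed.

Lemma enormN n (x : 'rV[R]_n) : enorm (- x) = enorm x.
Proof. by rewrite /enorm dotvN. Qed.

Lemma measurable_punctured_ball n : measurable (@punctured_ball R n).
Proof.
rewrite (_ : @punctured_ball R n = @enorm R n @^-1` `]0, 1]%classic); last first.
  by apply/seteqP; split => x /=; rewrite in_itv.
by rewrite -[X in measurable X]setTI; exact: measurable_enorm.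
Qed.

(** [unitv] commutes with [-%R] and the punctured ball is symmetric, so the cone over the opposite
    of [A] is the opposite of the cone over [A]. *)
Lemma sphere_measureN n (A : set 'rV[R]_n) : measurable A ->
  sphere_measure (-%R @^-1` A) = sphere_measure A.
Proof.
move=> mA; rewrite /sphere_measure; congr (_ * _)%E.
rewrite -[RHS]lebN; last first.
  apply: measurableI; last exact: measurable_punctured_ball.
  by rewrite -[X in measurable X]setTI; exact: measurable_unitv.
congr (leb R n _); apply/seteqP; split => x /=;
  by rewrite /punctured_ball /= /unitv enormN scalerN.
Qed.

Definition reverse (d : nat) (x : phase R d) : phase R d := (x.1, - x.2).

Lemma measurable_reverse d : measurable_fun setT (@reverse d).
Proof.
apply: measurable_fun_pair; first exact: measurable_fst.
exact: (measurableT_comp (@measurable_oppmx d) measurable_snd).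
Qed.

(** The reversal acts inside each fibre over [r], where it is the antipodal map. *)
Lemma product_measure_reverse d (m : {measure set 'rV[R]_d -> \bar R})
    (A : set (phase R d)) : measurable A ->
  (m \x @sphere_measure R d)%E (@reverse d @^-1` A) =
  (m \x @sphere_measure R d)%E A.
Proof.
move=> mA; rewrite /product_measure1; apply: eq_integral => r _ /=.
rewrite -[RHS]sphere_measureN; last exact: measurable_xsection.
by congr sphere_measure; apply/seteqP; split => s; rewrite /xsection /= !inE.
Qed.

End reflection.

Lemma integrable_comp_invariant d (T : measurableType d) (R : realType)
    (mu : {measure set T -> \bar R}) (phi : T -> T) (f : T -> \bar R) :
  measurable_fun setT phi ->
  (forall A, measurable A -> mu (phi @^-1` A) = mu A) ->
  mu.-integrable setT f -> mu.-integrable setT (f \o phi).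
Proof.
move=> mphi muphi /integrableP[mf foo]; apply/integrableP; split.
  exact: measurableT_comp.
have mabsf : measurable_fun setT (abse \o f) by exact: measurableT_comp.
have abs0 : {in setT, forall y, (0 <= (abse \o f) y)%E} by move=> y _; exact: abse_ge0.
have /= <- := ge0_integral_pushforward mphi mu measurableT mabsf abs0.
rewrite (eq_measure_integral mu)//= => A mA _; exact: muphi.
Qed.

(** * Integrability of the boundary term *)

Section boundary.
Context (R : realType) (d : nat) (P : rte R d).
Implicit Types u v : rte_fun R d.

Lemma snN (x : phase R d) : sn P (reverse x) = - sn P x.
Proof. by rewrite /sn /dotv -sumrN; apply: eq_bigr => i _; rewrite mxE mulNr. Qed.

Lemma phase_bdry_reverse (x : phase R d) :
  phase_bdry P (reverse x) <-> phase_bdry P x.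
Proof. by rewrite /phase_bdry /reverse /usphere /= enormN. Qed.

(* [V1] only controls the inflow part of the boundary; the outflow part is its
   mirror image under [s -> - s], which preserves the measure. *)
Lemma boundary_integrable u v : W P u -> W P v ->
  (mubD P).-integrable setT
    (EFin \o ((fun x => `|sn P x| * bval u x * bval v x) \_ (phase_bdry P))).
Proof.
move=> [[_ _ bu _] _ eu] [[_ _ bv _] _ ev].
pose G : phase R d -> \bar R := fun x =>
  ((bweight P (bval u) \_ (inflow_bdry P)) x *
   (bweight P (bval v) \_ (inflow_bdry P)) x)%:E.
have iG : (mubD P).-integrable setT G by exact: Lfun2_integrableM.
have iGr : (mubD P).-integrable setT (G \o @reverse R d).
  apply: integrable_comp_invariant => //; first exact: measurable_reverse.
  by move=> A; exact: product_measure_reverse.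
apply: eq_integrable (integrableD measurableT iG iGr) => //.
have GE x : inflow_bdry P x -> G x = (`|sn P x| * bval u x * bval v x)%:E.
  move=> Ix; rewrite /G !patchE mem_set// /bweight mulrACA.
  by rewrite -expr2 sqr_sqrtr// mulrA.
have G0 x : ~ inflow_bdry P x -> G x = 0%E.
  by move=> Ix; rewrite /G !patchE memNset// mul0r.
move=> x _ /=; rewrite patchE; case: ifPn => [|]; rewrite ?inE ?notin_setE => bx.
  (* On the inflow part only [G] contributes; on the outflow part only its mirror image does, and
     evenness of the traces brings it back to [x]. Tangential directions have weight [0]. *)
  have [sx|sx|sx] := ltgtP (sn P x) 0.
  - rewrite GE// G0 ?adde0// => -[_] /=; rewrite snN oppr_lt0 => sx'.
    by have := lt_trans sx sx'; rewrite ltxx.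
  - rewrite G0; last by move=> -[_] /=; rewrite ltNge (ltW sx).
    rewrite GE; last first.
      by split; [exact/phase_bdry_reverse|rewrite /= snN oppr_lt0].
    by rewrite add0e snN normrN /reverse eu// ev.
  - rewrite sx normr0 !mul0r !G0 ?adde0// => -[_] /=; rewrite ?snN sx ?oppr0 ltxx//.
rewrite !G0 ?adde0// => -[] //.
by move/phase_bdry_reverse.
Qed.

End boundary.

(** * The transport problem *)

Section transport.
Context (R : realType) (d : nat) (P : rte R d) (c0 : R).
Local Notation lebd := (leb R d).
Local Notation sph := (@sphere_measure R d).
Local Notation mu := (lebd \x sph)%E.
Local Notation D := (phase_dom P).
Implicit Types (f g : phase R d -> R) (u v z : rte_fun R d).

Lemma dotvC (s s' : 'rV[R]_d) : dotv s s' = dotv s' s.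
Proof. by apply: eq_bigr => i _; rewrite mulrC. Qed.

Lemma usphere_dotv (s : 'rV[R]_d) : usphere s -> dotv s s = 1.
Proof.
rewrite /usphere /= /enorm => s1.
have s0 : 0 <= dotv s s by apply: sumr_ge0 => i _; rewrite -expr2 sqr_ge0.
by rewrite -[LHS]sqr_sqrtr// s1 expr1n.
Qed.

Lemma usphere_dotv_bound (s s' : 'rV[R]_d) :
  usphere s -> usphere s' -> -1 <= dotv s s' <= 1.
Proof.
move=> /usphere_dotv s1 /usphere_dotv s'1.
(* Expands the square of [s - e s']; the choices [e = 1] and [e = -1] give the upper and the lower
   bound. *)
have h (e : R) : e ^+ 2 = 1 -> 2 * (e * dotv s s') <= dotv s s + dotv s' s'.
  move=> e2; rewrite /dotv !mulr_sumr -big_split /=.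
  apply: ler_sum => i _; rewrite -subr_ge0.
  have -> : s 0 i * s 0 i + s' 0 i * s' 0 i - 2 * (e * (s 0 i * s' 0 i)) =
     (s 0 i - e * s' 0 i) ^+ 2 + (1 - e ^+ 2) * s' 0 i ^+ 2 by ring.
  by rewrite e2 subrr mul0r addr0 sqr_ge0.
rewrite s1 s'1 in h; have N1 : (-1) ^+ 2 = 1 :> R by rewrite sqrrN expr1n.
by have := h 1 (expr1n _ _); have := h (-1) N1; lra.
Qed.

Lemma measurable_usphere : measurable (@usphere R d).
Proof.
rewrite (_ : @usphere R d = @enorm R d @^-1` [set 1])//.
by rewrite -[X in measurable X]setTI; exact: measurable_enorm.
Qed.

Lemma measurable_dotv :
  measurable_fun setT (fun p : 'rV[R]_d * 'rV[R]_d => dotv p.1 p.2).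
Proof.
apply: measurable_sum => i; apply: measurable_funM.
  exact: (measurableT_comp (@measurable_entry R 1 d 0 i) measurable_fst).
exact: (measurableT_comp (@measurable_entry R 1 d 0 i) measurable_snd).
Qed.

(** Assumptions on [theta] concern [[-1, 1]] only, while the kernel lemmas want a measurable
    nonnegative function everywhere; hence the cut-offs. Restricting both arguments to the sphere
    keeps the kernel symmetric. *)
Definition phase_kernel (p : 'rV[R]_d * 'rV[R]_d) : R :=
  (theta P \_ [set t : R | -1 <= t <= 1]) (dotv p.1 p.2) *
  (\1_(@usphere R d) p.1 * \1_(@usphere R d) p.2).

Lemma phase_kernel_sym s s' : phase_kernel (s, s') = phase_kernel (s', s).
Proof. by rewrite /phase_kernel /= dotvC (mulrC (\1__ s)). Qed.

Lemma phase_kernelE s s' : usphere s ->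
  phase_kernel (s, s') = ((fun s' => theta P (dotv s s')) \_ (@usphere R d)) s'.
Proof.
move=> ss; rewrite /phase_kernel /= !patchE !indicE (mem_set ss) mul1r.
have [s's|s's] := pselect (usphere s'); last by rewrite !(memNset s's) mulr0.
by rewrite !(mem_set s's) mulr1 mem_set//; exact: usphere_dotv_bound.
Qed.

Hypothesis adm : admissible P c0.

Lemma measurable_phase_kernel : measurable_fun setT phase_kernel.
Proof.
have [_ [_ [[mth _ _] _]]] := adm.
have mI : measurable [set t : R | -1 <= t <= 1].
  rewrite (_ : [set _ | _] = `[-1, 1]%classic); first exact: measurable_itv.
  by apply/seteqP; split => t /=; rewrite in_itv.
apply: measurable_funM.
  apply: measurableT_comp measurable_dotv.
  by apply/(measurable_restrictT _ mI).
apply: measurable_funM.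
  apply: measurableT_comp measurable_fst.
  exact: measurable_indic measurable_usphere.
apply: measurableT_comp measurable_snd.
exact: measurable_indic measurable_usphere.
Qed.

Lemma phase_kernel_ge0 p : 0 <= phase_kernel p.
Proof.
have [_ [_ [[_ th0 _] _]]] := adm.
apply: mulr_ge0; last by rewrite mulr_ge0.
by rewrite patchE; case: ifPn => //; rewrite inE; exact: th0.
Qed.

(** The mass is [1] for almost every [s] on the sphere, and [0] off the sphere, where the kernel
    vanishes. *)
Lemma phase_kernel_le1 :
  {ae sph, forall s, \int[sph]_s' (phase_kernel (s, s'))%:E <= 1}%E.
Proof.
have [_ [_ [[_ _ th1] _]]] := adm.
apply: filterS th1 => s; have [ss /(_ ss) <-|ss _] := pselect (usphere s).
  rewrite [leRHS]integral_mkcond le_eqVlt; apply/orP; left; apply/eqP.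
  apply: eq_integral => s' _; rewrite phase_kernelE// !patchE.
  by case: ifPn.
rewrite integral0_eq// => s' _; rewrite /phase_kernel /= indicE memNset//.
by rewrite mul0r mulr0.
Qed.

(* Extended by [0] outside the domain; its square is nonnegative everywhere,
   whereas [sigma_t] is so only almost everywhere. *)
Definition sqrt_sigma_t (r : 'rV[R]_d) : R := Num.sqrt ((sigma_t P \_ (dom P)) r).

Lemma measurable_sqrt_sigma_t : measurable_fun setT sqrt_sigma_t.
Proof.
have [_ [[_ + _ _ _] _]] := adm; rewrite /Linfty inE => /andP[]; rewrite inE /= => mt _.
apply: (@measurableT_comp _ _ _ _ _ _ (@Num.sqrt R)) mt.
by apply: continuous_measurable_fun; exact: sqrt_continuous.
Qed.

Lemma sqrt_sigma_t_bounded :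
  exists2 M : R, 0 <= M & {ae lebd, forall r, sqrt_sigma_t r ^+ 2 <= M}.
Proof.
have [_ [[_ + _ _ _] _]] := adm; rewrite /Linfty inE => /andP[_]; rewrite inE /=.
rewrite /finite_norm; have := Lnormy_ae lebd (sigma_t P \_ (dom P)).
have := Lnorm_ge0 lebd +oo%E (EFin \o (sigma_t P \_ (dom P))).
case: (Lnorm _ _ _) => [M||] //; rewrite lee_fin => M0 tM _; exists M => //.
apply: filterS tM => r; rewrite lee_fin /sqrt_sigma_t => tM.
(* [Num.sqrt] is [0] on negative numbers, so the bound holds there too. *)
have [t0|t0] := leP 0 ((sigma_t P \_ (dom P)) r).
  by rewrite sqr_sqrtr// (le_trans (ler_norm _)).
by rewrite ler0_sqrtr ?expr0n//= ltW.
Qed.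

Lemma rho_ge0 : 0 <= rho P.
Proof. by rewrite /rho fine_ge0// Lnorm_ge0. Qed.

Lemma sqrt_sigma_t_sqr :
  {ae lebd, forall r, dom P r -> sqrt_sigma_t r ^+ 2 = sigma_t P r}.
Proof.
have [_ [[_ _ pos _ _] _]] := adm; apply: filterS pos => r h dr.
by have [_ t0] := h dr; rewrite /sqrt_sigma_t patchE mem_set// sqr_sqrtr// ltW.
Qed.

(** [rho] is the [fine] of an essential supremum, which bounds the quotient only once it is known to
    be finite; positivity of [sigma_a] puts the quotient below [1]. *)
Lemma sigma_s_le : {ae lebd, forall r,
  0 <= (sigma_s P \_ (dom P)) r <= rho P * sqrt_sigma_t r ^+ 2}.
Proof.
have [_ [[_ _ pos c00 ca] _]] := adm.
pose q r := sigma_s P r / sigma_t P r.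
have q1 : {ae lebd, forall r, (`|(q \_ (dom P)) r|%:E <= 1)%E}.
  apply: filterS2 pos ca => r pr cr; rewrite patchE.
  case: ifPn => [|_]; last by rewrite normr0 lee_fin.
  rewrite inE lee_fin => dr; have [s0 t0] := pr dr; have c := cr dr.
  rewrite ger0_norm; last by rewrite divr_ge0// ltW.
  rewrite ler_pdivrMr// mul1r /sigma_t lerDr.
  by rewrite (le_trans (ltW c00)).
have Nfin : ('N[lebd]_+oo[EFin \o (q \_ (dom P))] \is a fin_num)%E.
  rewrite ge0_fin_numE ?Lnorm_ge0//; rewrite unlock.
  case: ifPn => // _; apply: (@le_lt_trans _ _ 1%E); last exact: ltry.
  exact/ess_supP.
have := Lnormy_ae lebd (q \_ (dom P)).
rewrite -(fineK Nfin); apply: filterS3 pos sqrt_sigma_t_sqr => r pr tr.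
rewrite !patchE lee_fin; case: ifPn => [|_ _].
  rewrite inE => dr; have [s0 t0] := pr dr; rewrite tr//.
  rewrite (ltW s0)/= => qr.
  rewrite -ler_pdivrMr//; apply: le_trans qr; exact: ler_norm.
by rewrite lexx/= mulr_ge0 ?sqr_ge0// rho_ge0.
Qed.

(** * The scattering form in terms of the kernel *)

Local Notation scat_s := (sigma_s P \_ (dom P)).
Local Notation K := (kernel_opr sph phase_kernel).

Lemma Lfun_sqrt_sigma_t f : f \in Lfun mu 2%:E ->
  (fun x => sqrt_sigma_t x.1 * f x) \in Lfun mu 2%:E.
Proof.
move=> /Lfun2P[mf f2]; apply/Lfun2P.
have mt : measurable_fun setT (fun x : phase R d => sqrt_sigma_t x.1).
  exact: (measurableT_comp measurable_sqrt_sigma_t measurable_fst).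
split; first exact: measurable_funM.
have [M M0 tM] := sqrt_sigma_t_bounded.
apply: (@le_lt_trans _ _ (\int[mu]_x (M%:E * (f x ^+ 2)%:E))%E).
  apply: ae_ge0_le_integral => //.
  - by move=> x _; rewrite lee_fin sqr_ge0.
  - by apply/measurable_EFinP; apply: measurable_funX; exact: measurable_funM.
  - by move=> x _; rewrite lee_fin mulr_ge0// sqr_ge0.
  - by apply/measurable_EFinP; apply: measurable_funM => //; exact: measurable_funX.
  apply: filterS (ae_product1 sph tM) => x tMx _.
  by rewrite lee_fin exprMn; apply: ler_wpM2r => //; exact: sqr_ge0.
rewrite ge0_integralZl_EFin//.
- by rewrite lte_mul_pinfty// lee_fin.
- by move=> x _; rewrite lee_fin sqr_ge0.
- by apply/measurable_EFinP; exact: measurable_funX.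
Qed.

Lemma scatteringE f x : D x ->
  scattering P f x = scat_s x.1 * K (f \_ D) x.
Proof.
move=> Dx; have [dx sx] := Dx.
rewrite /scattering patchE mem_set//; congr (_ * _).
rewrite Rintegral_mkcond /kernel_opr; apply: eq_Rintegral => s' _.
rewrite phase_kernelE// !patchE.
have [s's|s's] := pselect (usphere s'); last by rewrite (memNset s's) mul0r.
by rewrite !mem_set.
Qed.

Lemma sformE f g :
  sform P f g = \int[mu]_x (scat_s x.1 * K (f \_ D) x * (g \_ D) x).
Proof.
rewrite /sform /L2inner Rintegral_mkcond; apply: eq_Rintegral => x _.
rewrite [LHS]patchE [X in _ = _ * X]patchE; case: ifPn => [|_]; last by rewrite mulr0.
by rewrite inE => Dx; rewrite scatteringE.
Qed.

Lemma measurable_scat_s : measurable_fun setT scat_s.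
Proof.
have [_ [[ms _ _ _ _] _]] := adm.
by move: ms; rewrite /Linfty inE => /andP[]; rewrite inE.
Qed.

(** The bound is a real number, so it also yields the integrability of the integrand. *)
Lemma scattering_le f g : f \in Lfun mu 2%:E -> g \in Lfun mu 2%:E ->
  (\int[mu]_x `|scat_s x.1 * K f x * g x|%:E <=
   (2^-1 * (rho P ^+ 2 * \int[mu]_x ((sqrt_sigma_t x.1 * f x) ^+ 2) +
            \int[mu]_x ((sqrt_sigma_t x.1 * g x) ^+ 2)))%:E)%E.
Proof.
move=> f2 g2.
have tau0 : {ae lebd, forall r, 0 <= scat_s r <= rho P * sqrt_sigma_t r ^+ 2}.
  exact: sigma_s_le.
have mt2 : measurable_fun setT (fun r => sqrt_sigma_t r ^+ 2).
  by apply: measurable_funX; exact: measurable_sqrt_sigma_t.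
have t20 r : 0 <= sqrt_sigma_t r ^+ 2 by exact: sqr_ge0.
apply: le_trans (integral_scattering_le measurable_phase_kernel phase_kernel_ge0
  phase_kernel_sym phase_kernel_le1 mt2 measurable_scat_s tau0 t20 f2 g2) _.
have itf := Lfun2_integrable_sqr (Lfun_sqrt_sigma_t f2).
have itg := Lfun2_integrable_sqr (Lfun_sqrt_sigma_t g2).
rewrite EFinM EFinD EFinM /Rintegral !fineK ?integrable_fin_num//.
rewrite -integralZl//.
rewrite le_eqVlt; apply/orP; left; apply/eqP; congr (_ * (_ + _))%E;
  apply: eq_integral => x _; rewrite /= ?exprMn//.
by rewrite -EFinM; congr EFin; ring.
Qed.

Lemma integrable_scattering f g : f \in Lfun mu 2%:E -> g \in Lfun mu 2%:E ->
  mu.-integrable setT (EFin \o (fun x => scat_s x.1 * K f x * g x)).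
Proof.
move=> f2 g2; have [mf _] := (Lfun2P mu f).1 f2; have [mg _] := (Lfun2P mu g).1 g2.
apply/integrableP; split.
  apply/measurable_EFinP; apply: measurable_funM => //; apply: measurable_funM.
    exact: (measurableT_comp measurable_scat_s measurable_fst).
  exact: measurable_kernel_opr measurable_phase_kernel _ mf.
exact: le_lt_trans (scattering_le f2 g2) (ltry _).
Qed.

Lemma restrictB f g : (f \- g) \_ D = (f \_ D) \- (g \_ D).
Proof.
by apply/funext => x /=; rewrite !patchE; case: ifPn; rewrite ?subr0.
Qed.

(** * The squared weighted norm and the energy estimate *)

Definition energy f : R := \int[mu]_x ((sqrt_sigma_t x.1 * f x) ^+ 2).

Lemma energy_ge0 f : 0 <= energy f.
Proof. by apply: Rintegral_ge0 => x _; exact: sqr_ge0. Qed.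

Lemma L2_value u : W P u -> (value u \_ D) \in Lfun mu 2%:E.
Proof.
move=> [[ev _ _ _] od _].
have -> : value u \_ D = (even_part (value u) \_ D) \+ (odd_part (value u) \_ D).
  apply/funext => x; rewrite /= !patchE; case: ifPn => _; last by rewrite addr0.
  by rewrite /even_part /odd_part; lra.
by apply: rpredD => //; exact: lee1n.
Qed.

(** The weight is shared between the two factors, which makes this term the bilinear form polarising
    [energy]. *)
Lemma tform_values u z : W P u -> W P z ->
  L2inner (muD R d) D (fun x => sigma_t P x.1 * value u x) (value z) =
  \int[mu]_x ((sqrt_sigma_t x.1 * (value u \_ D) x) *
              (sqrt_sigma_t x.1 * (value z \_ D) x)).
Proof.
move=> /L2_value u2 /L2_value z2.
transitivity (\int[mu]_x ((sigma_t P \_ (dom P)) x.1 * (value u \_ D) x *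
    (value z \_ D) x)).
  rewrite /L2inner Rintegral_mkcond; apply: eq_Rintegral => x _.
  rewrite !patchE; case: ifPn => [|_]; last by rewrite !mulr0.
  by rewrite inE => -[dx _]; rewrite mem_set.
have [_ [[_ + _ _ _] _]] := adm; rewrite /Linfty inE => /andP[]; rewrite inE /= => mt _.
apply/esym/Rintegral_ae_eq.
- exact: Lfun2_integrableM (Lfun_sqrt_sigma_t u2) (Lfun_sqrt_sigma_t z2).
- apply: measurable_funM; last by have [] := (Lfun2P mu _).1 z2.
  apply: measurable_funM; last by have [] := (Lfun2P mu _).1 u2.
  exact: (measurableT_comp mt measurable_fst).
- apply: filterS (ae_product1 sph sqrt_sigma_t_sqr) => x tx.
  rewrite !patchE; case: ifPn => [|_]; last by rewrite !mulr0.
  by rewrite inE => -[dx _]; rewrite mem_set// -tx//; ring.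
Qed.

(* The equations are only tested with [u] and [z] themselves, so that [W] need not
   be known to be closed under subtraction. *)
Lemma transport_energy f g u z :
  L2 (muD R d) D f -> L2 (muD R d) D g ->
  transport_solution P f u -> transport_solution P g z ->
  energy ((value u \_ D) \- (value z \_ D)) <=
  \int[mu]_x (scat_s x.1 * K ((f \- g) \_ D) x *
              ((value u \_ D) x - (value z \_ D) x)).
Proof.
move=> f2 g2 [Wu hu] [Wz hz].
have u2 := L2_value Wu; have z2 := L2_value Wz.
have huu := hu _ Wu; have huz := hu _ Wz; have hzu := hz _ Wu; have hzz := hz _ Wz.
have e2 := Lfun2B u2 z2; have h2 := Lfun2B f2 g2.
have swap v w : L2inner (muD R d) D (odd_part (value v)) (sgrad w) =
    L2inner (muD R d) D (sgrad w) (odd_part (value v)).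
  by rewrite /L2inner; apply: eq_Rintegral => x _; rewrite mulrC.
pose B v w := \int[mubD P]_(x in phase_bdry P) (`|sn P x| * bval v x * bval w x).
(* The merged integrand is [|s.n|] times the square of the difference of the traces; merging
   requires each of the four integrals to converge. *)
have BE : 0 <= B u u - B u z - B z u + B z z.
  have BR v w : B v w = \int[mubD P]_x
      (((fun x => `|sn P x| * bval v x * bval w x) \_ (phase_bdry P)) x).
    exact: Rintegral_mkcond.
  rewrite !BR -RintegralBBD;
    [|exact: boundary_integrable..].
  apply: Rintegral_ge0 => x _; rewrite !patchE.
  case: ifPn => _; last by rewrite !subr0 addr0.
  rewrite (_ : _ + _ = `|sn P x| * (bval u x - bval z x) ^+ 2); last by ring.
  by rewrite mulr_ge0// sqr_ge0.
have TE : energy ((value u \_ D) \- (value z \_ D)) =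
    L2inner (muD R d) D (fun x => sigma_t P x.1 * value u x) (value u) -
    L2inner (muD R d) D (fun x => sigma_t P x.1 * value u x) (value z) -
    L2inner (muD R d) D (fun x => sigma_t P x.1 * value z x) (value u) +
    L2inner (muD R d) D (fun x => sigma_t P x.1 * value z x) (value z).
  rewrite !tform_values// -RintegralBBD;
    [|exact: Lfun2_integrableM (Lfun_sqrt_sigma_t _) (Lfun_sqrt_sigma_t _)..].
  by apply: eq_Rintegral => x _ /=; ring.
have SE : \int[mu]_x (scat_s x.1 * K ((f \- g) \_ D) x *
              ((value u \_ D) x - (value z \_ D) x)) =
   sform P f (value u) - sform P f (value z) - sform P g (value u) +
   sform P g (value z).
  rewrite !sformE -RintegralBBD; [|exact: integrable_scattering..].
  (* The average of [f - g] splits only almost everywhere, so the integrands are compared up to a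
     null set. *)
  rewrite restrictB; apply: Rintegral_ae_eq.
  - exact: integrable_scattering.
  - have m F G : F \in Lfun mu 2%:E -> G \in Lfun mu 2%:E ->
        measurable_fun setT (fun x => scat_s x.1 * K F x * G x).
      move=> F2 G2.
      by have /integrableP[/measurable_EFinP] := integrable_scattering F2 G2.
    apply: measurable_funD; last exact: m.
    by apply: measurable_funB; [apply: measurable_funB|]; exact: m.
  apply: filterS (kernel_oprB measurable_phase_kernel phase_kernel_ge0
    phase_kernel_sym phase_kernel_le1 f2 g2) => x ->; ring.
have tE v w : tform P v w =
    L2inner (muD R d) D (sgrad v) (odd_part (value w)) -
    L2inner (muD R d) D (sgrad w) (odd_part (value v)) +
    L2inner (muD R d) D (fun x => sigma_t P x.1 * value v x) (value w) + B v w.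
  by rewrite /tform swap.
(* First minus second minus third plus fourth equation: the gradient terms [a] and the source terms
   [l] cancel, and the boundary terms [b] are dropped by their sign. *)
have lin (a12 a21 a11 a22 t11 t12 t21 t22 b11 b12 b21 b22 s11 s12 s21 s22 l1 l2 : R) :
    a11 - a11 + t11 + b11 = s11 + l1 -> a12 - a21 + t12 + b12 = s12 + l2 ->
    a21 - a12 + t21 + b21 = s21 + l1 -> a22 - a22 + t22 + b22 = s22 + l2 ->
    0 <= b11 - b12 - b21 + b22 ->
    t11 - t12 - t21 + t22 <= s11 - s12 - s21 + s22.
  by clear; lra.
rewrite TE SE; move: huu huz hzu hzz; rewrite !tE => huu huz hzu hzz.
exact: lin huu huz hzu hzz BE.
Qed.

(** [scattering_le] returns half the energy of the difference of the solutions, which is absorbed on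
    the left. *)
Lemma energy_contraction f g u z :
  L2 (muD R d) D f -> L2 (muD R d) D g ->
  transport_solution P f u -> transport_solution P g z ->
  energy ((value u \_ D) \- (value z \_ D)) <=
  rho P ^+ 2 * energy ((f \_ D) \- (g \_ D)).
Proof.
move=> f2 g2 fu gz.
have e2 := Lfun2B (L2_value fu.1) (L2_value gz.1); have h2 := Lfun2B f2 g2.
have := transport_energy f2 g2 fu gz; rewrite restrictB.
have := scattering_le h2 e2.
have iS := integrable_scattering h2 e2.
move=> /(le_trans (le_abse_integral mu measurableT (measurable_int _ iS))).
rewrite -(fineK (integrable_fin_num measurableT iS)) abse_EFin lee_fin.
rewrite -/(energy ((f \_ D) \- (g \_ D))).
rewrite -/(energy ((value u \_ D) \- (value z \_ D))) => h1 h3.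
have := le_trans h3 (le_trans (ler_norm _) h1); lra.
Qed.

(** * The weighted norm as a real number, and its triangle inequality *)

Definition energy_norm f : R := Num.sqrt (energy f).

Lemma Lnorm_sqrt_sigma_t f : f \in Lfun mu 2%:E ->
  ('N[mu]_2%:E[EFin \o (fun x => (sqrt_sigma_t x.1 * f x)%R)])%E = (energy_norm f)%:E.
Proof.
move=> f2; have itf := Lfun2_integrable_sqr (Lfun_sqrt_sigma_t f2).
rewrite unlock /energy_norm.
have -> : (\int[mu]_x (`|(EFin \o (fun x => (sqrt_sigma_t x.1 * f x)%R)) x| `^ 2) =
    (energy f)%:E)%E.
  rewrite /energy /Rintegral fineK; last exact: integrable_fin_num itf.
  by apply: eq_integral => x _ /=; rewrite powR_mulrn// real_normK// num_real.
by rewrite poweR12_sqrt// lee_fin energy_ge0.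
Qed.

Lemma sigma_normE f : L2 (muD R d) D f ->
  sigma_norm P f = (energy_norm (f \_ D))%:E.
Proof.
move=> f2; rewrite -Lnorm_sqrt_sigma_t// /sigma_norm /L2norm; apply: eq_Lnorm => x /=.
rewrite /sqrt_sigma_t !patchE; case: ifPn => [|_]; last by rewrite mulr0.
by rewrite inE => -[dx _]; rewrite mem_set.
Qed.

Lemma energy_normD f g : f \in Lfun mu 2%:E -> g \in Lfun mu 2%:E ->
  energy_norm (f \+ g) <= energy_norm f + energy_norm g.
Proof.
move=> f2 g2; have fg2 : (f \+ g) \in Lfun mu 2%:E.
  by apply: rpredD => //; exact: lee1n.
rewrite -lee_fin EFinD -!Lnorm_sqrt_sigma_t//.
have [mf _] := (Lfun2P mu _).1 (Lfun_sqrt_sigma_t f2).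
have [mg _] := (Lfun2P mu _).1 (Lfun_sqrt_sigma_t g2).
rewrite [X in (Lnorm _ _ (EFin \o X) <= _)%E](_ : _ =
    (fun x => sqrt_sigma_t x.1 * f x) \+ (fun x => sqrt_sigma_t x.1 * g x)).
  by apply: minkowski_EFin => //; rewrite ler1n.
by apply/funext => x /=; rewrite mulrDr.
Qed.

Lemma energy_norm_triangle f g h : f \in Lfun mu 2%:E -> g \in Lfun mu 2%:E ->
  h \in Lfun mu 2%:E ->
  energy_norm (f \- h) <= energy_norm (f \- g) + energy_norm (g \- h).
Proof.
move=> f2 g2 h2; rewrite (_ : f \- h = (f \- g) \+ (g \- h)).
  by apply: energy_normD; exact: Lfun2B.
by apply/funext => x /=; rewrite subrKA.
Qed.

Lemma transport_contraction f g u z :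
  L2 (muD R d) D f -> L2 (muD R d) D g ->
  transport_solution P f u -> transport_solution P g z ->
  energy_norm ((value u \_ D) \- (value z \_ D)) <=
  rho P * energy_norm ((f \_ D) \- (g \_ D)).
Proof.
move=> f2 g2 fu gz; rewrite -[X in X * _]ger0_norm ?rho_ge0// -sqrtr_sqr.
rewrite -sqrtrM ?sqr_ge0//.
by apply: ler_wsqrtr; exact: energy_contraction.
Qed.

(** * Residuals and the error bound *)

Hypothesis solv : transport_solvable P.

Definition residual_norm f : R :=
  energy_norm ((value (xget 0 (transport_solution P f)) \_ D) \- (f \_ D)).

Lemma transport_xget f : L2 (muD R d) D f ->
  transport_solution P f (xget 0 (transport_solution P f)).
Proof. by move=> /solv; exact: (@xgetPex _ 0 (transport_solution P f)). Qed.

Lemma sigma_norm_residual f : L2 (muD R d) D f ->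
  sigma_norm P (residual P f) = (residual_norm f)%:E.
Proof.
move=> f2.
have rE : residual P f \_ D =
    (value (xget 0 (transport_solution P f)) \_ D) \- (f \_ D) := restrictB _ _.
rewrite sigma_normE /L2 rE//; apply: Lfun2B => //.
exact: L2_value (transport_xget f2).1.
Qed.

(** [z] need not be the solution picked by [xget], but the contraction with equal data puts the two
    at distance [0]. *)
Lemma residual_normE f z : L2 (muD R d) D f -> transport_solution P f z ->
  energy_norm ((value z \_ D) \- (f \_ D)) <= residual_norm f.
Proof.
move=> f2 fz; have fx := transport_xget f2.
have z2 := L2_value fz.1; have x2 := L2_value fx.1.
apply: le_trans (energy_norm_triangle z2 x2 f2) _.
rewrite gerDr; apply: le_trans (transport_contraction f2 f2 fz fx) _.
rewrite /energy_norm (_ : energy _ = 0) ?sqrtr0 ?mulr0//.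
rewrite /energy (@eq_Rintegral _ _ _ _ _ (cst 0)); first by rewrite /Rintegral integral0.
by move=> x _ /=; rewrite subrr mulr0 expr0n.
Qed.

(** The residual of [z] is the difference of the solutions with data [z] and [f], and [z - f] is
    itself the residual of [f]. *)
Lemma residual_norm_step f z : L2 (muD R d) D f -> transport_solution P f z ->
  residual_norm (value z) <= rho P * residual_norm f.
Proof.
move=> f2 fz; have z2 : L2 (muD R d) D (value z) := L2_value fz.1.
apply: le_trans (transport_contraction z2 f2 (transport_xget z2) fz) _.
by apply: ler_wpM2l; [exact: rho_ge0|exact: residual_normE].
Qed.

(** The weak solution solves the transport problem with itself as scattering data, so the
    contraction compares it with the solution for [f]. *)
Lemma error_le_residual f u : L2 (muD R d) D f -> weak_solution P u -> rho P < 1 ->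
  energy_norm ((value u \_ D) \- (f \_ D)) <= residual_norm f / (1 - rho P).
Proof.
move=> f2 wu r1; have fx := transport_xget f2.
have u2 := L2_value wu.1; have x2 := L2_value fx.1.
have h1 := transport_contraction u2 f2 wu fx.
have h2 := energy_norm_triangle u2 x2 f2.
rewrite ler_pdivlMr ?subr_gt0//.
by move: h1 h2; rewrite -/(residual_norm f); lra.
Qed.

End transport.

(** * Correction spaces *)

Section subspaces.
Context (R : realType) (d : nat) (P : rte R d).

Lemma subspace_of_dim0 (N : nat) (WN : set (rte_fun R d)) :
  subspace_of_dim P N WN -> WN 0.
Proof.
move=> [e [_ _ ->]]; exists (fun=> 0) => //.
by rewrite big1// => i _; rewrite scale0r.
Qed.

Lemma L2_subspace (N : nat) (WN : set (rte_fun R d)) w :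
  subspace_of_dim P N WN -> WN w -> L2 (muD R d) (phase_dom P) (value w).
Proof.
move=> [e [We _ ->]] [a _ <-].
elim/big_ind : _ => [|u v u2 v2|i _].
- rewrite /L2 (_ : _ \_ _ = 0); first by apply: rpred0; exact: lee1n.
  by apply/funext => x; rewrite patchE; case: ifPn.
- rewrite /L2 (_ : _ \_ _ = value u \_ (phase_dom P) + value v \_ (phase_dom P)).
    by apply: rpredD => //; exact: lee1n.
  by apply/funext => x; rewrite /= !patchE addrfctE !patchE;
    case: ifPn; rewrite ?addr0.
- rewrite /L2 (_ : _ \_ _ = a i *: (value (e i) \_ (phase_dom P))).
    by apply: rpredZ => [|?]; [exact: lee1n|exact: L2_value (We i)].
  by apply/funext => x; rewrite /= scalrfctE !patchE;
    case: ifPn; rewrite ?scaler0.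
Qed.

End subspaces.

Theorem theorem1p2 (R : realType) (d : nat) (P : rte R d) (c0 : R)
    (u : rte_fun R d)
    (u_ : nat -> phase R d -> R) (uhalf ucorr : nat -> rte_fun R d)
    (N : nat -> nat) (WN : nat -> set (rte_fun R d)) :
  (0 < d)%N ->
  admissible P c0 ->
  rho P < 1 ->
  transport_solvable P ->
  weak_solution P u ->
  L2 (muD R d) (phase_dom P) (u_ 0%N) ->
  (forall k, transport_solution P (u_ k) (uhalf k)) ->
  (forall k, subspace_of_dim P (N k) (WN k)) ->
  (forall k, is_argmin (WN k)
     (fun w => sigma_norm P (residual P (value (uhalf k + w)))) (ucorr k)) ->
  (forall k, u_ k.+1 = value (uhalf k + ucorr k)) ->
  forall k, (sigma_norm P (fun x => value u x - u_ k x)%R <=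
    (rho P ^+ k / (1 - rho P))%:E * sigma_norm P (residual P (u_ 0%N)))%E.
Proof.
move=> _ adm r1 solv wu u0 half sub argm unext k.
have L2half j : L2 (muD R d) (phase_dom P) (value (uhalf j)).
  exact: L2_value (half j).1.
(* Every iterate must be square integrable for its residual to be meaningful. *)
have L2u j : L2 (muD R d) (phase_dom P) (u_ j).
  case: j => [//|j]; rewrite unext.
  have -> : value (uhalf j + ucorr j) = value (uhalf j) \+ value (ucorr j) by [].
  have cj := L2_subspace (sub j) (argm j).1.
  rewrite /L2 (_ : _ \_ _ = (value (uhalf j) \_ (phase_dom P)) \+
      (value (ucorr j) \_ (phase_dom P))).
    by apply: rpredD => [|?|?]; [exact: lee1n|exact: L2half|exact: cj].
  by apply/funext => x; rewrite /= !patchE; case: ifPn; rewrite ?addr0.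
have step j : residual_norm P (u_ j.+1) <= rho P * residual_norm P (u_ j).
  apply: le_trans (residual_norm_step adm solv (L2u j) (half j)).
  (* The competitor [0] gives the residual of the half step itself. *)
  have := (argm j).2 0 (subspace_of_dim0 (sub j)).
  by rewrite addr0 -unext !(sigma_norm_residual adm solv)// lee_fin.
have rk : residual_norm P (u_ k) <= rho P ^+ k * residual_norm P (u_ 0%N).
  elim: k => [|k ih]; first by rewrite expr0 mul1r.
  apply: le_trans (step k) _; rewrite exprS -mulrA.
  by apply: ler_wpM2l => //; exact: rho_ge0.
have eE : (fun x => value u x - u_ k x) \_ (phase_dom P) =
  (value u \_ (phase_dom P)) \- (u_ k \_ (phase_dom P)) := restrictB _ _ _.
rewrite (sigma_normE adm) ?(sigma_norm_residual adm solv)//; last first.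
  by rewrite /L2 eE; apply: Lfun2B => //; [exact: L2_value wu.1|exact: L2u].
rewrite -EFinM lee_fin eE mulrAC.
apply: le_trans (error_le_residual adm solv (L2u k) wu r1) _.
by apply: ler_wpM2r => //; rewrite invr_ge0 subr_ge0 ltW.
Qed.
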